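(* For every integer $r \geq 2$ there exists $C = C(r) > 0$ such that the following holds. Let $G$ be an $n$-vertex graph satisfying one of the following conditions: (1) $G$ is $3$-connected; (2) $G$ is $2$-connected and $s_r(G) \geq C\sqrt{n}$. Then $\mathcal{D}_r(G,\mathcal{T}_n) \geq \lfloor s_r(G)/C \rfloor$.
   Context: Graphs are finite and simple; ''$k$-connected'' means $k$-vertex-connected. Spanning-tree discrepancy: for a connected $n$-vertex graph $G$, an $r$-colouring $f:E(G)\to[r]$ of its edges, and a spanning tree $T$ of $G$ (which has $n-1$ edges), put $D_f(T) := r\cdot\left(\max_{1\le i\le r}|f^{-1}(i)\cap E(T)| - \frac{n-1}{r}\right)$. The $r$-colour spanning-tree discrepancy of $G$ is $\mathcal{D}_r(G,\mathcal{T}_n) := \min_{f:E(G)\to[r]}\ \max_{T} D_f(T)$, where the maximum is over all spanning trees $T$ of $G$. Balanced $r$-separation number: $s_r(G)$ is the minimum $s$ for which there is a partition $V(G)=V_1\cup\dots\cup V_r\cup S$ with $|V_1|=\dots=|V_r|$, $|S|=s$, and no edges of $G$ between $V_i$ and $V_j$ for any $1\le i<j\le r$ (the parts may be empty). *)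

(* Defs.v *)
From mathcomp Require Import all_boot all_order all_algebra.
Set Implicit Arguments.
Unset Strict Implicit.
Unset Printing Implicit Defensive.
Import Order.TTheory GRing.Theory Num.Theory.

Record sgraph (V : finType) := SGraph {
  adj :> rel V;
  adj_sym : symmetric adj;
  adj_irrefl : irreflexive adj
}.

Section Connectivity.
Variables (V : finType) (G : sgraph V).

Definition del_adj (S : {set V}) : rel V :=
  [rel x y | [&& adj G x y, x \notin S & y \notin S]].

Definition k_connected (k : nat) : Prop :=
  k < #|V| /\
  forall S : {set V}, #|S| < k ->
    forall x y, x \notin S -> y \notin S -> connect (del_adj S) x y.

End Connectivity.

Section Separation.
Variables (V : finType) (G : sgraph V) (r : nat).

(* An ordered partition V_1, ..., V_r, S with possibly empty parts is encoded
   by p : V -> option 'I_r, with V_i = p^-1(Some i) and S = p^-1(None). *)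
Definition separation := {ffun V -> option 'I_r}.

Definition sep_part (p : separation) (i : 'I_r) : {set V} :=
  [set x | p x == Some i].

Definition sep_set (p : separation) : {set V} := [set x | p x == None].

Definition balanced_separation (p : separation) : bool :=
  [forall i : 'I_r, forall j : 'I_r, #|sep_part p i| == #|sep_part p j|] &&
  [forall i : 'I_r, forall j : 'I_r, (i < j) ==>
     [forall x in sep_part p i, forall y in sep_part p j, ~~ adj G x y]].

Lemma balanced_separation_exists :
  exists s, [exists p, balanced_separation p && (#|sep_set p| == s)].
Proof.
have part0 i : sep_part [ffun=> None] i = set0.
  by apply/setP=> x; rewrite !inE ffunE.
exists #|sep_set [ffun=> None]|; apply/existsP; exists [ffun=> None].
rewrite eqxx andbT; apply/andP; split; apply/forallP=> i; apply/forallP=> j.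
  by rewrite !part0.
by apply/implyP=> _; apply/forall_inP=> x; rewrite part0 inE.
Qed.

Definition sep_number : nat := ex_minn balanced_separation_exists.

End Separation.

Local Open Scope ring_scope.

(* The default value 0 is only taken over an empty range. *)
Definition fin_max (I : finType) (P : pred I) (F : I -> rat) : rat :=
  if [pick i | P i] is Some i0 then F [arg max_(i > i0 | P i) F i]%O else 0.

Definition fin_min (I : finType) (P : pred I) (F : I -> rat) : rat :=
  if [pick i | P i] is Some i0 then F [arg min_(i < i0 | P i) F i]%O else 0.

Section Discrepancy.
Variables (V : finType) (G : sgraph V).

Definition edge_set : {set {set V}} :=
  [set A : {set V} | [exists x, exists y, adj G x y && (A == [set x; y])]].

Definition edge : finType := {A : {set V} | A \in edge_set}.

Definition sub_adj (T : {set edge}) : rel V :=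
  [rel x y | [exists e in T, val e == [set x; y]]].

Definition sub_connected (T : {set edge}) : bool :=
  [forall x, forall y, connect (sub_adj T) x y].

(* Bounding the length of a cycle by #|V| loses nothing since its vertices are
   distinct. *)
Definition sub_acyclic (T : {set edge}) : bool :=
  [forall k : 'I_#|V|.+1, (2 < k)%N ==>
     [forall c : k.-tuple V, ~~ ucycleb (sub_adj T) c]].

Definition spanning_tree (T : {set edge}) : bool :=
  sub_connected T && sub_acyclic T.

Variable r : nat.

Definition tree_disc (f : {ffun edge -> 'I_r}) (T : {set edge}) : rat :=
  r%:R * ((\max_(i < r) #|[set e in T | f e == i]|)%:R
          - (#|V|%:R - 1) / r%:R).

Definition spanning_tree_discrepancy : rat :=
  fin_min xpredT (fun f : {ffun edge -> 'I_r} =>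
    fin_max spanning_tree (tree_disc f)).

End Discrepancy.

(* Main.v *)
Require Import Defs.
From mathcomp Require Import all_boot all_order all_algebra.
From mathcomp Require Import zify ring lra.
From mathcomp Require Import reals.
Set Implicit Arguments.
Unset Strict Implicit.
Unset Printing Implicit Defensive.
Import Order.TTheory GRing.Theory Num.Theory.

(* Fix a colouring all of whose spanning trees have discrepancy less than [k].
   A spanning tree can contain a maximal forest of any one colour, so each
   colour class has rank about at most [(n + k) / r], and the ranks add up to
   less than [n + k].  Call the nontrivial monochromatic components blobs.  The
   bipartite incidence graph between blobs and the boundary vertices (those in
   at least two blobs) then has cyclomatic number less than [k], and by
   2-connectedness it has minimum degree at least 2: it consists of O(k) branch
   nodes joined by paths.  Deleting the O(k) boundary vertices near the branch
   nodes leaves only chains of blobs.  If [G] is 3-connected there are no chains,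
   since a blob with two boundary vertices is a single edge.  Otherwise delete
   the ends of the blobs with more than [M] vertices, where [M] is about
   [sqrt n], and cut the remaining chains into pieces of size O(M), at the cost
   of O(k + M) further vertices.  What remains is monochromatic or in small
   pieces; the monochromatic parts of one colour do not overfill a class, and the
   small pieces are distributed greedily.  Hence s_r(G) = O(k) in the first case
   and O(k + sqrt n) in the second. *)

(** * Cutting, packing and trimming *)

Section DegreeTwoCut.
Variables (T : finType) (h : rel T) (wt : T -> nat) (M c : nat).
Hypothesis sym_h : symmetric h.

Definition nbhd (W A : {set T}) : {set T} :=
  [set u in W :\: A | [exists a in A, h a u]].

(** Take [A] maximal containing [a], of weight at most [M + c] and with at most two outer
    neighbours. If its weight is below [M], an outer neighbour [b] could be absorbed: [b] already
    has one of its two neighbours in [A], so at most one new outer neighbour replaces it. *)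
Lemma grow_block (W : {set T}) (a : T) : a \in W ->
  (forall w, w \in W -> wt w <= c) ->
  (forall w, w \in W -> #|[set u in W | h w u]| <= 2) ->
  exists A : {set T}, [/\ A \subset W, a \in A, \sum_(w in A) wt w <= M + c
    & M * #|nbhd W A| <= 2 * \sum_(w in A) wt w].
Proof.
move=> aW wt_le deg_le.
pose P (A : {set T}) := [&& A \subset W, a \in A, \sum_(w in A) wt w <= M + c
  & #|nbhd W A| <= 2].
have P1 : P [set a].
  rewrite /P sub1set aW set11 big_set1 /=; apply/andP; split.
    by move: (wt_le _ aW); clear; lia.
  apply: leq_trans (deg_le _ aW); apply: subset_leq_card; apply/subsetP => u.
  by rewrite !inE => /andP[/andP[_ ->]] /exists_inP[x]; rewrite inE => /eqP ->.
have [A maxA _] := maxset_exists P1.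
have /maxsetP[/and4P[AW aA wtA NA] maxP] := maxA.
exists A; split=> //.
have [NA0|[b bN]] := set_0Vmem (nbhd W A); first by rewrite NA0 cards0 muln0.
have [wtM|wtM] := leqP M (\sum_(w in A) wt w).
  by rewrite mulnC; apply: leq_mul.
have := bN; rewrite inE => /andP[/setDP[bW bA] /exists_inP[x xA hxb]].
suff /maxP/(_ (subsetU1 _ _)) eqA : P (b |: A).
  by move: bA; rewrite -eqA setU11.
apply/and4P; split.
- by rewrite subUset sub1set bW.
- by rewrite inE aA orbT.
- by rewrite big_setU1 //=; move: (wt_le _ bW) wtM; clear; lia.
have xN : x \in [set u in W | h b u] by rewrite inE (subsetP AW) //= sym_h.
have := deg_le _ bW; rewrite (cardsD1 x) xN => deg_b.
have sub : nbhd W (b |: A) \subset (nbhd W A :\ b) :|: ([set u in W | h b u] :\ x).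
  apply/subsetP => u; rewrite !inE negb_or.
  move=> /andP[/andP[/andP[ub uA] uW] /exists_inP[y]].
  rewrite !inE ub uA uW /= => /orP[/eqP-> hbu|yA hyu].
    by rewrite hbu andbT; apply/orP; right; apply: contraNneq uA => ->.
  by apply/orP; left; apply/exists_inP; exists y.
move: (leq_trans (subset_leq_card sub) (leq_card_setU _ _)).
by move: (cardsD1 b (nbhd W A)) deg_b NA; rewrite bN; clear; lia.
Qed.

(* Cutting off disjoint blocks of weight about [M], each at the price of its at
   most two outer neighbours, leaves only light classes. *)
Lemma degree2_cut (W : {set T}) :
  (forall w, w \in W -> wt w <= c) ->
  (forall w, w \in W -> #|[set u in W | h w u]| <= 2) ->
  exists X : {set T}, exists l : T -> T,
  [/\ M * #|X| <= 2 * \sum_(w in W) wt w,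
      {in W :\: X &, forall u v, h u v -> l u = l v},
      {in W :\: X, forall u, l u \in W}
    & forall t, \sum_(u in W :\: X | l u == t) wt u <= M + c].
Proof.
have [m] := ubnP #|W|; elim: m => // m IHm in W * => Wm wt_le deg_le.
have [->|[a aW]] := set_0Vmem W.
  exists set0, id; rewrite cards0 muln0 set0D; split=> //.
  - by move=> u v uS; rewrite inE in uS.
  by move=> t; rewrite big_pred0 // => u; rewrite inE.
have [A [AW aA wtA NA]] := grow_block aW wt_le deg_le.
pose W' := W :\: A :\: nbhd W A.
have subW' : W' \subset W :\: A by apply: subsetDl.
have subW : W' \subset W by apply: subset_trans subW' (subsetDl _ _).
have [||w wW|X [l [wtX hl lW lt]]] := IHm W'.
- rewrite -ltnS; apply: leq_trans Wm; rewrite ltnS; apply: proper_card.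
  apply/properP; split=> //; exists a => //.
  by apply/negP => /(subsetP subW'); rewrite inE aA.
- by move=> w /(subsetP subW)/wt_le.
- apply: leq_trans (deg_le _ (subsetP subW _ wW)).
  apply: subset_leq_card; apply/subsetP => u; rewrite !inE.
  by case/andP=> /and3P[_ _ ->].
have inWX u : u \in W :\: (nbhd W A :|: X) -> u \notin A -> u \in W' :\: X.
  by rewrite /W' !in_setD in_setU negb_or => /andP[/andP[-> ->] ->] ->.
have AnotW' u : u \in W' -> u \notin A.
  by move/(subsetP subW'); rewrite inE => /andP[].
have cross u v : u \in A -> v \notin A -> v \in W :\: (nbhd W A :|: X) -> ~~ h u v.
  move=> uA vA; rewrite !inE vA /= negb_or => /andP[/andP[vN _] vW].
  move: vN; rewrite vW /=; apply: contra => huv.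
  by apply/exists_inP; exists u.
exists (nbhd W A :|: X), (fun u => if u \in A then a else l u); split.
- have cU : M * #|nbhd W A :|: X| <= M * #|nbhd W A| + M * #|X|.
    by rewrite -mulnDr leq_mul2l leq_card_setU orbT.
  have sW : \sum_(w in A) wt w + \sum_(w in W') wt w <= \sum_(w in W) wt w.
    rewrite [leqRHS](big_setID A) /= (setIidPr AW) leq_add2l.
    by rewrite [leqRHS](big_setID W') /= (setIidPr subW') leq_addr.
  by move: cU sW NA wtX; clear; lia.
- move=> u v uW vW huv.
  case: ifPn => uA; case: ifPn => vA //.
  + by have := cross _ _ uA vA vW; rewrite huv.
  + by have := cross _ _ vA uA uW; rewrite sym_h huv.
  by apply: hl => //; apply: inWX.
- move=> u uW; case: ifPn => // uA.
  by apply: (subsetP subW); apply/lW/inWX.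
(* Labels inherited from the recursion lie in [W'], which avoids [A]; hence the class of [a] lies in
   the new block and the other classes are old ones. *)
move=> t; have [->|ta] := eqVneq t a.
  apply: leq_trans wtA; rewrite [leqRHS]big_mkcond [leqLHS]big_mkcond /=.
  apply: leq_sum => u _; case: ifP => // /andP[uW].
  case: ifPn => // uA /eqP lua.
  by have := AnotW' _ (lW _ (inWX _ uW uA)); rewrite lua aA.
apply: leq_trans (lt t); rewrite [leqRHS]big_mkcond [leqLHS]big_mkcond /=.
apply: leq_sum => u _; case: ifP => // /andP[uW].
case: ifPn => [uA|uA /eqP <-]; first by rewrite eq_sym (negPf ta).
by rewrite inWX // eqxx.
Qed.

End DegreeTwoCut.

(** Each item goes into a currently smallest bin. That bin holds at most the average, so [r] times
    its content stays below [n + r * c] after the insertion. *)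
Lemma greedy_bins (r n c B : nat) (L : finType) (a : L -> nat) (b : 'I_r -> nat) :
  0 < r -> (forall l, a l <= c) -> (forall i, r * b i <= B) -> n + r * c <= B ->
  \sum_i b i + \sum_l a l <= n ->
  exists g : L -> 'I_r, forall i, r * (b i + \sum_(l | g l == i) a l) <= B.
Proof.
case: r b => // r b _ a_le b_le nB.
have main (s : seq L) : uniq s -> \sum_i b i + \sum_(l <- s) a l <= n ->
    exists g : L -> 'I_r.+1,
      forall i, r.+1 * (b i + \sum_(l <- s | g l == i) a l) <= B.
  elim: s b b_le => [|l s IHs] b b_le /=.
    by move=> _ _; exists (fun=> ord0) => i; rewrite big_nil addn0.
  case/andP=> ls us; rewrite big_cons => tot.
  case: (@arg_minnP _ ord0 xpredT b isT) => j _ jmin.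
  have rbj : r.+1 * b j <= \sum_i b i.
    rewrite -{1}[r.+1]card_ord -sum_nat_const; apply: leq_sum => i _; exact: jmin.
  pose b' i := b i + (if i == j then a l else 0).
  have [i||g hg] := IHs b' _ us.
  - rewrite /b'; case: eqP => [->|_]; last by rewrite addn0.
    have := leq_mul (leqnn r.+1) (a_le l); rewrite mulnDr /=.
    have := leq_trans rbj (leq_trans (leq_addr _ _) tot).
    by move: nB; clear; lia.
  - by rewrite /b' big_split /= -big_mkcond /= big_pred1_eq -addnA.
  exists (fun x => if x == l then j else g x) => i.
  have := hg i; rewrite /b' big_cons eqxx.
  have -> : \sum_(x <- s | (if x == l then j else g x) == i) a x
          = \sum_(x <- s | g x == i) a x.
    rewrite big_seq_cond [RHS]big_seq_cond; apply: eq_bigl => x.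
    case xs : (x \in s) => //=; have [xl|//] := eqVneq x l.
    by rewrite -xl xs in ls.
  rewrite eq_sym; case: ifP => _; lia.
move=> tot; apply: main; first exact: index_enum_uniq.
by [].
Qed.

Lemma exists_subset_card (T : finType) (A : {set T}) (m : nat) :
  m <= #|A| -> exists2 B : {set T}, B \subset A & #|B| = m.
Proof.
move=> mA; exists [set x in take m (enum A)].
  by apply/subsetP => x; rewrite inE => /mem_take; rewrite mem_enum.
rewrite cardsE (card_uniqP _) ?take_uniq ?enum_uniq // size_take -cardE.
by case: ltngtP mA.
Qed.

Lemma leq_card_bigcup (T J : finType) (P : pred J) (F : J -> {set T}) :
  #|\bigcup_(j | P j) F j| <= \sum_(j | P j) #|F j|.
Proof.
elim/big_rec2: _ => [|j n A _ le_n]; first by rewrite cards0.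
by apply: leq_trans (leq_card_setU _ _) _; rewrite leq_add2l.
Qed.

Lemma card_fibers (T J : finType) (A : {set T}) (phi : T -> J) :
  #|A| = \sum_j #|[set x in A | phi x == j]|.
Proof.
rewrite -sum1_card (partition_big phi xpredT) //=.
by apply: eq_bigr => j _; rewrite -sum1_card; apply: eq_bigl => x; rewrite inE.
Qed.

Section SepNumber.
Variables (V : finType) (G : sgraph V) (r : nat).

Lemma sep_number_leq (p : separation V r) :
  balanced_separation G p -> sep_number G r <= #|sep_set p|.
Proof.
move=> bal; rewrite /sep_number; case: ex_minnP => m _; apply.
by apply/existsP; exists p; rewrite bal eqxx.
Qed.

Lemma sep_number_leq_card : sep_number G r <= #|V|.
Proof.
rewrite /sep_number; case: ex_minnP => m /existsP[p /andP[_ /eqP <-]] _.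
exact: max_card.
Qed.

End SepNumber.

(** Every class is trimmed to the size of the smallest class [Q j], and the trimmed vertices join
    the separator. The other [r - 1] classes have at most [(#|V| + e) / r] vertices each, which
    bounds [#|Q j|] from below. *)
Lemma sep_number_leq_trim (V : finType) (G : sgraph V) (r : nat)
    (S : {set V}) (phi : V -> 'I_r) (e : nat) :
  1 < r ->
  (forall x y, x \notin S -> y \notin S -> adj G x y -> phi x = phi y) ->
  (forall i, r * #|[set x in ~: S | phi x == i]| <= #|V| + e) ->
  sep_number G r <= r * #|S| + r * e.
Proof.
case: r phi => // q phi q1 adj_phi size_phi.
pose Q i := [set x in ~: S | phi x == i].
case: (@arg_minnP _ ord0 xpredT (fun i => #|Q i|) isT) => j _ jmin.
have /fin_all_exists2[R RQ cardR] :
    forall i, exists2 B : {set V}, B \subset Q i & #|B| = #|Q j|.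
  by move=> i; apply: exists_subset_card; apply: jmin.
have inR x i : x \in R i -> x \notin S /\ phi x = i.
  by move/(subsetP (RQ i)); rewrite !inE => /andP[? /eqP].
pose p : separation V q.+1 :=
  [ffun x => if x \in R (phi x) then Some (phi x) else None].
have partR i : sep_part p i = R i.
  apply/setP=> x; rewrite inE ffunE; apply/eqP/idP.
    by case: ifP => // xR [<-].
  by move=> xR; have [_ <-] := inR _ _ xR; rewrite ifT //; have [_ ->] := inR _ _ xR.
have bal : balanced_separation G p.
  apply/andP; split; apply/forallP=> i; apply/forallP=> i'.
    by rewrite !partR !cardR.
  apply/implyP=> ii'; apply/forall_inP=> x; rewrite partR => /inR[xS xi].
  apply/forall_inP=> y; rewrite partR => /inR[yS yi]; apply/negP => /adj_phi.
  by rewrite xi yi => /(_ xS yS) eqi; rewrite eqi ltnn in ii'.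
apply: leq_trans (sep_number_leq bal) _.
have cardp : #|sep_set p| + q.+1 * #|Q j| = #|V|.
  rewrite -(cardsC (sep_set p)) (card_fibers (~: sep_set p) phi); congr (_ + _).
  have -> : q.+1 * #|Q j| = \sum_(i < q.+1) #|Q j|.
    by rewrite sum_nat_const card_ord.
  apply: eq_bigr => i _; rewrite -(cardR i); apply: eq_card => x; rewrite !inE ffunE.
  apply/idP/andP => [xR|[]].
    by have [_ xi] := inR _ _ xR; rewrite xi xR eqxx.
  by case: ifP => // xR _ /eqP <-.
have cardV : #|V| <= #|S| + (#|Q j| + \sum_(i < q.+1 | i != j) #|Q i|).
  by rewrite -(cardsC S) leq_add2l (card_fibers (~: S) phi) (bigD1 j).
have : q.+1 * \sum_(i < q.+1 | i != j) #|Q i| <= q * (#|V| + e).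
  rewrite big_distrr /=.
  have -> : q * (#|V| + e) = \sum_(i < q.+1 | i != j) (#|V| + e).
    by rewrite sum_nat_const cardC1 card_ord.
  by apply: leq_sum => i _; apply: size_phi.
nia.
Qed.

(** * Families of blobs *)

Section KConnected.
Variables (V : finType) (G : sgraph V).

Lemma k_connectedW (m k : nat) : m <= k -> k_connected G k -> k_connected G m.
Proof.
move=> mk [kV conn]; split; first exact: leq_ltn_trans kV.
by move=> S Sm; apply: conn; apply: leq_trans mk.
Qed.

Lemma k_connected_connect (k : nat) (x y : V) :
  0 < k -> k_connected G k -> connect (adj G) x y.
Proof.
move=> k0 [_ conn]; have := conn set0; rewrite cards0 => /(_ k0 x y).
rewrite !inE => /(_ isT isT); apply: connect_sub => u v /and3P[uv _ _].
exact: connect1.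
Qed.

(** Otherwise deleting the neighbours of [x] isolates it from a vertex outside its closed
    neighbourhood, which exists because [k < #|V|]. *)
Lemma k_connected_degree (k : nat) (x : V) :
  k_connected G k -> k <= #|[set y | adj G x y]|.
Proof.
move=> [kV conn]; rewrite leqNgt; apply/negP => degk.
pose N := [set y | adj G x y].
have xN : x \notin N by rewrite inE adj_irrefl.
have /subsetPn[y _ yN] : ~~ ([set: V] \subset x |: N).
  apply: contraL kV => /subset_leq_card; rewrite cardsT cardsU1 xN -leqNgt.
  by move=> le; apply: leq_trans le degk.
move: yN; rewrite in_setU1 negb_or => /andP[yx yN].
have /connectP[[|z p] /=] := conn N degk x y xN yN.
  by move=> _ yx'; rewrite yx' eqxx in yx.
by case/andP=> /and3P[xz _]; rewrite inE xz.
Qed.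

End KConnected.

(* Only these counting properties of the blobs [K b], with colours [col b], are
   needed: neither their connectedness nor that blobs of one colour are disjoint. *)
Section Cover.
Variables (V : finType) (G : sgraph V) (r : nat) (I : finType).
Variables (K : I -> {set V}) (col : I -> 'I_r) (k : nat).
Hypothesis r_gt1 : 1 < r.
Hypothesis adj_cover :
  forall x y, adj G x y -> exists b, (x \in K b) && (y \in K b).
Hypothesis K_gt1 : forall b, 1 < #|K b|.
Hypothesis rank_col :
  forall i, r * \sum_(b | col b == i) #|K b|.-1 + 2 <= #|V| + k.

Definition mult (v : V) : nat := #|[set b | v \in K b]|.
Definition bdry : {set V} := [set v | 1 < mult v].

Lemma sum_rank : \sum_b #|K b|.-1 + 2 <= #|V| + k.
Proof.
have r0 : 0 < r by apply: ltnW.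
rewrite -(leq_pmul2l r0) mulnDr.
rewrite (partition_big col xpredT) //= big_distrr /=.
have -> : r * 2 = \sum_(i < r) 2 by rewrite sum_nat_const card_ord.
have -> : r * (#|V| + k) = \sum_(i < r) (#|V| + k).
  by rewrite sum_nat_const card_ord.
by rewrite -big_split; apply: leq_sum => i _; apply: rank_col.
Qed.

Lemma sum_card_setI (A : {set V}) :
  \sum_b #|K b :&: A| = \sum_(v in A) mult v.
Proof.
under eq_bigr do rewrite -sum1_card big_mkcond.
rewrite exchange_big [RHS]big_mkcond /=; apply: eq_bigr => v _.
rewrite /mult -sum1_card [in RHS]big_mkcond /=.
case vA : (v \in A); last by apply: big1 => b _; rewrite inE vA andbF.
by apply: eq_bigr => b _; rewrite !inE vA andbT.
Qed.

Lemma sum_card : \sum_b #|K b| = \sum_v mult v.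
Proof.
have := sum_card_setI setT.
under eq_bigr do rewrite setIT.
by under [in RHS]eq_bigl do rewrite inE.
Qed.

Lemma mem_unique (v : V) (b b' : I) :
  v \notin bdry -> v \in K b -> v \in K b' -> b = b'.
Proof.
rewrite inE -leqNgt => /card_le1_eqP eqb vb vb'.
by apply: eqb; rewrite inE.
Qed.

(* Otherwise the boundary of the blob separates its interior from the rest. *)
Lemma blob_boundary (c : nat) (b : I) :
  k_connected G c -> K b != setT -> #|K b :&: bdry| < c -> K b \subset bdry.
Proof.
move=> [_ conn] Kneq bc; apply: contraNT Kneq => /subsetPn[x xb xN].
apply/eqP/setP => y; rewrite inE; case yK : (y \in K b) => //.
have xS : x \notin K b :&: bdry by rewrite inE (negPf xN) andbF.
have yS : y \notin K b :&: bdry by rewrite inE yK.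
have /connectP[p] := conn _ bc x y xS yS.
elim: p x xb xN {xS} => [|z p IHp] x xb xN /=.
  by move=> _ yx; rewrite yx xb in yK.
case/andP=> /and3P[xz _ zS]; have [b' /andP[xb' zb']] := adj_cover xz.
rewrite -(mem_unique xN xb xb') in zb'.
by apply: IHp => //; move: zS; rewrite inE zb'.
Qed.

(** * Counting and cutting boundary vertices in a 2-connected graph *)

Section TwoConnected.
Hypothesis conn2 : k_connected G 2.
Hypothesis K_proper : forall b, K b != setT.

Lemma mult_gt0 v : 0 < mult v.
Proof.
have := k_connected_degree v conn2; case: (set_0Vmem [set y | adj G v y]).
  by move->; rewrite cards0.
case=> y; rewrite inE => /adj_cover[b /andP[vb _]] _.
by apply/card_gt0P; exists b; rewrite inE.
Qed.

Lemma boundary_gt1 b : 1 < #|K b :&: bdry|.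
Proof.
rewrite ltnNge; apply/negP => le1.
have /setIidPl eqK := blob_boundary conn2 (K_proper b) le1.
by move: le1; rewrite eqK leqNgt K_gt1.
Qed.

(* The incidence graph of blobs and boundary vertices has cyclomatic number at
   most [k - 1] and minimum degree at least [2]. *)
Lemma excess :
  \sum_(v in bdry) (mult v - 2) + \sum_b (#|K b :&: bdry| - 2) + 4 <= 2 * k.
Proof.
have sr := sum_rank.
have E1 : \sum_b #|K b|.-1 + #|I| = \sum_b #|K b|.
  rewrite -sum1_card -big_split; apply: eq_bigr => b _ /=.
  by have := K_gt1 b; lia.
have E2 : \sum_(v in bdry) (mult v - 2) + 2 * #|bdry| = \sum_(v in bdry) mult v.
  rewrite mulnC -sum_nat_const -big_split; apply: eq_bigr => v /=.
  by rewrite inE; lia.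
have E3 : \sum_b (#|K b :&: bdry| - 2) + 2 * #|I| = \sum_(v in bdry) mult v.
  rewrite -sum_card_setI mulnC -sum_nat_const -big_split.
  by apply: eq_bigr => b _ /=; rewrite subnK // boundary_gt1.
have E4 : \sum_b #|K b| = \sum_(v in bdry) mult v + #|~: bdry|.
  rewrite sum_card (bigID (mem bdry)) /=; congr (_ + _).
  rewrite -sum1_card; apply: eq_big => [v|v]; first by rewrite !inE.
  by rewrite inE -leqNgt => le1; apply/eqP; rewrite eqn_leq le1 mult_gt0.
have E5 := cardsC bdry.
(* Let [D] be the number of incidences between blobs and boundary vertices. [E1], [E4] and [E5] turn
   [sr] into [D - #|I| - #|bdry| <= k - 2]; by [E2] and [E3] the two sums of the goal add up to
   twice that difference. *)
by move: sr E1 E2 E3 E4 E5; clear; lia.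
Qed.

Variable M : nat.

Definition big_blob : {set I} := [set b | M < #|K b|].

Definition bad_bdry : {set V} :=
  [set v in bdry | (2 < mult v) ||
     [exists b, (v \in K b) && ((2 < #|K b :&: bdry|) || (M < #|K b|))]].

Definition good_bdry : {set V} := bdry :\: bad_bdry.

(** Bad vertices are charged to [excess]: a vertex in three blobs counts at least 1 there, and a
    blob with [m > 2] boundary vertices has [m <= 3 * (m - 2)]. Big blobs with [m = 2] account for
    the last term. *)
Lemma card_bad_bdry : #|bad_bdry| <= 6 * k + 2 * #|big_blob|.
Proof.
pose V3 := [set v in bdry | 2 < mult v].
pose bad b := (2 < #|K b :&: bdry|) || (M < #|K b|).
have sub : bad_bdry \subset V3 :|: \bigcup_(b | bad b) (K b :&: bdry).
  apply/subsetP => v; rewrite !inE => /andP[v1 /orP[->|]]; first by rewrite v1.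
  case/existsP=> b /andP[vb badb]; apply/orP; right.
  by apply/bigcupP; exists b => //; rewrite !inE vb.
have le1 := leq_trans (subset_leq_card sub) (leq_card_setU _ _).
have le2 : #|V3| <= \sum_(v in bdry) (mult v - 2).
  rewrite -sum1_card big_mkcond [leqRHS]big_mkcond /=; apply: leq_sum => v _.
  rewrite !inE; case: ifP => [/andP[-> ]|_ //]; first by rewrite subn_gt0.
have le3 : #|\bigcup_(b | bad b) (K b :&: bdry)| <=
    3 * \sum_b (#|K b :&: bdry| - 2) + 2 * #|big_blob|.
  apply: leq_trans (leq_card_bigcup _ _) _.
  have -> : 2 * #|big_blob| = \sum_(b in big_blob) 2 by rewrite sum_nat_const mulnC.
  rewrite big_distrr [X in _ + X]big_mkcond -big_split big_mkcond /=.
  apply: leq_sum => b _; rewrite inE /bad.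
  have := boundary_gt1 b; move: #|_ :&: _| (M < _) => m [] m1.
    by rewrite orbT; move: m1; clear; lia.
  by rewrite orbF; case: ifP => //; move: m1; clear; lia.
by have := excess; move: le1 le2 le3; clear; lia.
Qed.

(** Good vertices are inner nodes of the paths of the incidence graph: the lower bounds 2 on both
    kinds of degree become equalities. *)
Lemma good_bdryP w : w \in good_bdry ->
  [/\ w \in bdry, mult w = 2 &
      forall b, w \in K b -> #|K b :&: bdry| = 2 /\ #|K b| <= M].
Proof.
rewrite inE => /andP[+ wb]; rewrite inE wb /= negb_or -leqNgt => /andP[m2 ex].
split=> //; first by apply/eqP; rewrite eqn_leq m2; move: wb; rewrite inE.
move=> b wK; move/existsPn/(_ b): ex; rewrite wK /= negb_or -!leqNgt.
by case/andP=> b2 ->; split=> //; apply/eqP; rewrite eqn_leq b2 boundary_gt1.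
Qed.

Definition share_blob : rel V :=
  [rel u v | (u != v) && [exists b, (u \in K b) && (v \in K b)]].

(** An upper bound for the number of vertices in the blobs through [v]; a class of boundary vertices
    thus bounds the size of the piece of [G] around it. *)
Definition weight (v : V) : nat := \sum_(b | v \in K b) #|K b|.

Lemma share_blob_sym : symmetric share_blob.
Proof.
move=> u v; rewrite /share_blob /= eq_sym; congr (_ && _).
by apply: eq_existsb => b; rewrite andbC.
Qed.

Lemma share_blob_degree w : w \in good_bdry ->
  #|[set u in good_bdry | share_blob w u]| <= 2.
Proof.
move=> wW; have [wb m2 wK] := good_bdryP wW.
have sub : [set u in good_bdry | share_blob w u] \subset
    \bigcup_(b | w \in K b) ((K b :&: bdry) :\ w).
  apply/subsetP => u; rewrite inE => /andP[uW /andP[wu /existsP[b /andP[wb' ub]]]].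
  apply/bigcupP; exists b => //; have [ubd _ _] := good_bdryP uW.
  by rewrite in_setD1 in_setI eq_sym wu ub.
apply: leq_trans (subset_leq_card sub) _.
apply: leq_trans (leq_card_bigcup _ _) _.
rewrite -[leqRHS]m2 /mult -sum1_card.
under [leqRHS]eq_bigl do rewrite inE.
apply: leq_sum => b wb'; have [b2 _] := wK _ wb'.
by have := cardsD1 w (K b :&: bdry); rewrite b2 inE wb' wb; clear; lia.
Qed.

Lemma weight_leq w : w \in good_bdry -> weight w <= M + M.
Proof.
move=> wW; have [wb m2 wK] := good_bdryP wW.
have -> : M + M = \sum_(b | w \in K b) M.
  rewrite sum_nat_const -(eq_card (fun b => in_set (fun b => w \in K b) b)).
  by rewrite -/(mult w) m2 mul2n addnn.
by apply: leq_sum => b /wK[].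
Qed.

(** Exchanging the sums counts each blob once per good vertex in it, hence at most twice, and
    [#|K b| <= 2 * #|K b|.-1]. *)
Lemma sum_weight : \sum_(w in good_bdry) weight w <= 4 * (#|V| + k).
Proof.
have -> : \sum_(w in good_bdry) weight w = \sum_b #|K b| * #|K b :&: good_bdry|.
  rewrite /weight; under eq_bigr do rewrite big_mkcond.
  rewrite exchange_big /=; apply: eq_bigr => b _.
  rewrite mulnC -sum_nat_const -big_mkcondr; apply: eq_bigl => w.
  by rewrite in_setI andbC.
have le2 b : #|K b| * #|K b :&: good_bdry| <= 4 * #|K b|.-1.
  have [->|[w]] := set_0Vmem (K b :&: good_bdry); first by rewrite cards0 muln0.
  rewrite inE => /andP[wb /good_bdryP[_ _ /(_ _ wb)[b2 _]]].
  have : #|K b :&: good_bdry| <= 2.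
    by rewrite -b2 subset_leq_card // setIS // subsetDl.
  have := K_gt1 b; clear; nia.
apply: leq_trans (leq_sum _ (fun b _ => le2 b)) _.
by rewrite -big_distrr leq_mul2l /= (leq_trans _ sum_rank) ?leq_addr.
Qed.

(** A blob with only two boundary vertices has no interior, so it is a pair; a good vertex, lying in
    two such pairs, would have degree at most 2. *)
Lemma good_bdry_3connected : k_connected G 3 -> good_bdry = set0.
Proof.
move=> conn3; apply/setP => w; rewrite in_set0; apply/negP => wW.
have [wb m2 wK] := good_bdryP wW.
have := k_connected_degree w conn3; rewrite leqNgt => /negP; apply.
have sub : [set y | adj G w y] \subset \bigcup_(b | w \in K b) (K b :\ w).
  apply/subsetP => u; rewrite inE => wu; have [b /andP[wb' ub]] := adj_cover wu.
  apply/bigcupP; exists b => //; rewrite !inE ub andbT.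
  by apply: contraTneq wu => ->; rewrite adj_irrefl.
rewrite ltnS; apply: leq_trans (subset_leq_card sub) _.
apply: leq_trans (leq_card_bigcup _ _) _.
rewrite -[leqRHS]m2 /mult -sum1_card.
under [leqRHS]eq_bigl do rewrite inE.
apply: leq_sum => b wb'; have [b2 _] := wK _ wb'.
have /setIidPl eqK : K b \subset bdry.
  by apply: blob_boundary conn3 (K_proper b) _; rewrite b2.
by have := cardsD1 w (K b); rewrite -{1}eqK b2 wb'; clear; lia.
Qed.

(** Outside the separator, a vertex sharing a blob with a surviving good vertex [w] inherits the
    label [l w]; any other vertex is interior to one blob and is labelled by its colour. Edges join
    equal labels, so the light [l]-classes can be packed around the colour classes and the result
    trimmed. *)
Lemma sep_number_cut (X : {set V}) (l : V -> V) (c : nat) :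
  {in good_bdry :\: X &, forall u v, share_blob u v -> l u = l v} ->
  (forall t, \sum_(u in good_bdry :\: X | l u == t) weight u <= c) ->
  sep_number G r <= r * (#|bad_bdry| + #|X|) + r * (k + r * c).
Proof.
move=> hl wt_l; pose S := bad_bdry :|: X; pose U := good_bdry :\: X.
have bdryU x : x \notin S -> x \in bdry -> x \in U.
  by rewrite in_setU negb_or => /andP[xb xX] xbd; rewrite !in_setD xX xb.
have [beta betaP] : exists beta : V -> I, forall x, x \in K (beta x).
  apply: (@fin_all_exists _ (fun _ : V => I) (fun x b => x \in K b)) => x.
  by have /card_gt0P[b] := mult_gt0 x; rewrite inE; exists b.
pose near x w := [exists b, (x \in K b) && (w \in K b)].
pose lam x : 'I_r + V :=
  if [pick w in U | near x w] is Some w then inr (l w) else inl (col (beta x)).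
have sameU b u v : u \in U -> v \in U -> u \in K b -> v \in K b -> l u = l v.
  move=> uU vU ub vb; have [->//|uv] := eqVneq u v.
  by apply: hl => //; rewrite /share_blob /= uv; apply/existsP; exists b; rewrite ub.
have lamE x w : x \notin S -> w \in U -> near x w -> lam x = inr (l w).
  move=> xS wU xw; rewrite /lam; case: pickP => [w' /andP[w'U xw']|/(_ w)]; last first.
    by rewrite wU xw.
  congr inr; have /existsP[b /andP[xb wb]] := xw.
  have /existsP[b' /andP[xb' wb']] := xw'.
  have [xbd|xN] := boolP (x \in bdry).
    have xU := bdryU _ xS xbd.
    by rewrite -(sameU _ _ _ xU w'U xb' wb') (sameU _ _ _ xU wU xb wb).
  by rewrite -(mem_unique xN xb xb') in wb'; apply: sameU wb' wb.
have lam_adj1 x y w : x \notin S -> y \notin S -> adj G x y -> w \in U ->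
    near x w -> lam x = lam y.
  move=> xS yS xy wU xw; rewrite (lamE _ _ xS wU xw).
  have /existsP[b /andP[xb wb]] := xw; have [b' /andP[xb' yb']] := adj_cover xy.
  have [xbd|xN] := boolP (x \in bdry).
    have xU := bdryU _ xS xbd; rewrite -(sameU _ _ _ xU wU xb wb).
    by apply/esym/lamE => //; apply/existsP; exists b'; rewrite yb' xb'.
  rewrite -(mem_unique xN xb xb') in yb'.
  by apply/esym/lamE => //; apply/existsP; exists b; rewrite yb' wb.
have lam_far x : x \notin S -> ~~ [exists w in U, near x w] ->
    x \notin bdry /\ lam x = inl (col (beta x)).
  move=> xS xfar; split.
    apply: contra xfar => /(bdryU _ xS) xU; apply/exists_inP; exists x => //.
    by apply/existsP; exists (beta x); rewrite betaP.
  rewrite /lam; case: pickP => // w /andP[wU xw].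
  by case/exists_inP: xfar; exists w.
have lam_adj x y : x \notin S -> y \notin S -> adj G x y -> lam x = lam y.
  move=> xS yS xy.
  have [/exists_inP[w wU xw]|xfar] := boolP [exists w in U, near x w].
    exact: lam_adj1 xw.
  have [/exists_inP[w wU yw]|yfar] := boolP [exists w in U, near y w].
    by rewrite adj_sym in xy; rewrite (lam_adj1 _ _ _ yS xS xy wU yw).
  have [xN ->] := lam_far _ xS xfar; have [yN ->] := lam_far _ yS yfar.
  have [b /andP[xb yb]] := adj_cover xy.
  by rewrite (mem_unique xN (betaP x) xb) (mem_unique yN (betaP y) yb).
pose a t := #|[set x in ~: S | lam x == inr t]|.
pose b0 i := #|[set x in ~: S | lam x == inl i]|.
have a_le t : a t <= c.
  apply: leq_trans (wt_l t).
  have sub : [set x in ~: S | lam x == inr t] \subset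
      \bigcup_(u in U | l u == t) \bigcup_(b | u \in K b) K b.
    apply/subsetP => x; rewrite inE /lam => /andP[_].
    case: pickP => // w /andP[wU /existsP[b /andP[xb wb]]] lw.
    by apply/bigcupP; exists w; [rewrite wU | apply/bigcupP; exists b].
  apply: leq_trans (subset_leq_card sub) _.
  apply: leq_trans (leq_card_bigcup _ _) _.
  by apply: leq_sum => u _; apply: leq_card_bigcup.
have b_le i : r * b0 i <= #|V| + (k + r * c).
  apply: (@leq_trans (#|V| + k)); last by rewrite addnA leq_addr.
  apply: leq_trans (rank_col i); apply: leq_trans (leq_addr _ _).
  rewrite leq_mul2l; apply/orP; right.
  have sub : [set x in ~: S | lam x == inl i] \subset
      \bigcup_(b | col b == i) (K b :\: bdry).
    apply/subsetP => x; rewrite inE inE => /andP[xS lamx].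
    have [/exists_inP[w wU xw]|xfar] := boolP [exists w in U, near x w].
      by rewrite (lamE _ _ xS wU xw) in lamx.
    have [xN lamx'] := lam_far _ xS xfar; rewrite lamx' in lamx.
    by apply/bigcupP; exists (beta x) => //; rewrite inE xN betaP.
  apply: leq_trans (subset_leq_card sub) _.
  apply: leq_trans (leq_card_bigcup _ _) _.
  (* A blob has boundary vertices, so its interior is no larger than its rank [#|K b|.-1]. *)
  apply: leq_sum => b _; have := cardsID bdry (K b); have := boundary_gt1 b.
  by clear; lia.
have tot : \sum_i b0 i + \sum_t a t <= #|V|.
  by have := card_fibers (~: S) lam; rewrite big_sumType /= => <-; apply: max_card.
have [|g hg] := greedy_bins (ltnW r_gt1) a_le b_le _ tot.
  by rewrite leq_add2l leq_addl.
pose phi x := match lam x with inl i => i | inr t => g t end.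
have le_S : #|S| <= #|bad_bdry| + #|X| by apply: leq_card_setU.
apply: (@leq_trans (r * #|S| + r * (k + r * c))); last first.
  by rewrite leq_add2r leq_mul2l le_S orbT.
apply: (@sep_number_leq_trim _ _ _ S phi) => // [x y xS yS xy|i].
  by rewrite /phi (lam_adj x y).
apply: leq_trans (hg i); rewrite leq_mul2l; apply/orP; right.
have sub : [set x in ~: S | phi x == i] \subset
    [set x in ~: S | lam x == inl i] :|:
    \bigcup_(t | g t == i) [set x in ~: S | lam x == inr t].
  apply/subsetP => x; rewrite inE => /andP[xS]; rewrite /phi.
  case lamx : (lam x) => [j|t] gi; rewrite in_setU.
    by rewrite (eqP gi) in lamx; rewrite inE xS lamx eqxx.
  apply/orP; right; apply/bigcupP; exists t => //.
  by rewrite inE xS lamx eqxx.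
apply: leq_trans (subset_leq_card sub) _.
apply: leq_trans (leq_card_setU _ _) _; rewrite leq_add2l.
exact: leq_card_bigcup.
Qed.

End TwoConnected.

(** One colour then has rank at least [#|V| - 1], and [r >= 2] in [rank_col] does the rest. This
    settles the case excluded by [K_proper], since the separation number is at most [#|V|]. *)
Lemma blob_spanning b : K b = setT -> #|V| <= k.
Proof.
move=> KT; have KV : #|K b| = #|V| by rewrite KT cardsT.
have := rank_col (col b); rewrite (bigD1 b) //= KV => rk.
have le2 : 2 * #|V|.-1 <= r * #|V|.-1 by rewrite leq_mul2r r_gt1 orbT.
have V_gt1 := K_gt1 b; rewrite KV in V_gt1.
have {}rk : r * #|V|.-1 + 2 <= #|V| + k.
  by apply: leq_trans rk; rewrite leq_add2r leq_mul2l leq_addr orbT.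
have aux n : 1 < n -> 2 * n.-1 + 2 <= n + k -> n <= k by clear; lia.
exact: aux V_gt1 (leq_trans (leq_add le2 (leqnn 2)) rk).
Qed.

Lemma sep_number_3connected :
  k_connected G 3 -> 0 < k /\ sep_number G r <= r * (7 * k).
Proof.
move=> conn3; have conn2 := k_connectedW (isT : 2 <= 3) conn3.
have [/existsP[b /eqP KT]|] := boolP [exists b, K b == setT].
  have Vk := blob_spanning KT; have [V3 _] := conn3.
  split; first by apply: leq_trans Vk; apply: leq_ltn_trans V3.
  apply: leq_trans (sep_number_leq_card _ _) _.
  have := leq_mul (ltnW r_gt1) Vk; clear; lia.
move/existsPn => K_proper; have ex := excess conn2 K_proper.
split; first by move: ex; clear; lia.
have good0 := good_bdry_3connected conn2 K_proper #|V| conn3.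
(* The threshold [M = #|V|] rules out big blobs, and without good vertices there is nothing to cut:
   [X] is empty and [c = 0]. *)
have cut : sep_number G r <=
    r * (#|bad_bdry (#|V|)| + #|set0 : {set V}|) + r * (k + r * 0).
  apply: (@sep_number_cut conn2 K_proper #|V| set0 id 0); rewrite good0 set0D.
    by move=> u v uS; rewrite inE in uS.
  by move=> t; rewrite big_pred0 // => u; rewrite inE.
move: cut.
have := card_bad_bdry conn2 K_proper #|V|.
have -> : big_blob #|V| = set0.
  by apply/setP=> b; rewrite !inE ltnNge max_card.
rewrite !cards0; clear; nia.
Qed.

Lemma sep_number_2connected (M : nat) : k_connected G 2 ->
  0 < M -> #|V| <= M * M -> 0 < k /\ sep_number G r <= 20 * (r * r) * (k + M).
Proof.
move=> conn2 M0 VM.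
have [/existsP[b /eqP KT]|] := boolP [exists b, K b == setT].
  have Vk := blob_spanning KT; have [V2 _] := conn2.
  split; first by apply: leq_trans Vk; apply: leq_ltn_trans V2.
  apply: leq_trans (sep_number_leq_card _ _) _.
  have : 0 < r * r by rewrite muln_gt0 (ltnW r_gt1).
  move: Vk; clear; nia.
move/existsPn => K_proper; have ex := excess conn2 K_proper.
split; first by move: ex; clear; lia.
(* A big blob has rank at least [M], while the ranks sum to less than [#|V| + k <= M * M + k]. *)
have card_big : #|big_blob M| <= M + k.
  rewrite -(leq_pmul2r M0).
  have le1 : #|big_blob M| * M <= \sum_b #|K b|.-1.
    rewrite -sum_nat_const big_mkcond; apply: leq_sum => b _.
    by rewrite inE; case: ifP => //; clear; lia.
  have := sum_rank; move: le1 VM M0; clear; nia.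
(* Single weights are at most [M + M], so the classes obtained have weight at most [3 * M]. *)
have [X [l [cX hl _ lt]]] := degree2_cut M share_blob_sym
  (@weight_leq conn2 K_proper M) (@share_blob_degree conn2 K_proper M).
have cX' : #|X| <= 8 * (M + k).
  rewrite -(leq_pmul2l M0); apply: leq_trans cX _.
  have := sum_weight conn2 K_proper M; move: VM M0; clear; nia.
apply: leq_trans (sep_number_cut conn2 K_proper hl lt) _.
have := card_bad_bdry conn2 K_proper M; move: card_big cX' r_gt1 M0; clear.
nia.
Qed.

End Cover.

(** * Spanning trees and colour classes *)

Lemma set2_eq (T : finType) (u v x y : T) :
  [set u; v] = [set x; y] -> u = x /\ v = y \/ u = y /\ v = x.
Proof.
move=> eq_uv.
have /set2P uP : u \in [set x; y] by rewrite -eq_uv set21.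
have /set2P vP : v \in [set x; y] by rewrite -eq_uv set22.
have /set2P xP : x \in [set u; v] by rewrite eq_uv set21.
have /set2P yP : y \in [set u; v] by rewrite eq_uv set22.
by case: uP => ?; case: vP => ?; case: xP => ?; case: yP => ?; subst; auto.
Qed.

Section SpanningTrees.
Variables (V : finType) (G : sgraph V).
Implicit Types (T E F : {set edge G}) (e : edge G).

Lemma sub_adjP T x y :
  reflect (exists2 e, e \in T & val e = [set x; y]) (sub_adj T x y).
Proof.
by apply: (iffP exists_inP) => [] [e eT /eqP ve]; exists e => //; apply/eqP.
Qed.

Lemma sub_adj_sym T : symmetric (sub_adj T).
Proof. by move=> x y; apply: eq_existsb => e; rewrite setUC. Qed.

Lemma adj_edge x y : adj G x y -> exists e : edge G, val e = [set x; y].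
Proof.
move=> xy; suff A : [set x; y] \in edge_set G.
  by exists (exist (fun B => B \in edge_set G) _ A).
by rewrite inE; apply/existsP; exists x; apply/existsP; exists y; rewrite xy /=.
Qed.

Lemma connect_setD1 T e x y : val e = [set x; y] ->
  connect (sub_adj (T :\ e)) x y ->
  forall u v, connect (sub_adj T) u v -> connect (sub_adj (T :\ e)) u v.
Proof.
move=> ve cxy; apply: connect_sub => u v /sub_adjP[e' e'T ve'].
have [ee|e'e] := eqVneq e' e; last first.
  by apply/connect1/sub_adjP; exists e'; rewrite // in_setD1 e'e.
move: ve'; rewrite ee ve => /esym/set2_eq[] [-> ->] //.
by rewrite (sym_connect_sym (sub_adj_sym _)).
Qed.

(** The rest of the cycle joins the ends of [e]. Rotated to start at [x], its edges differ from [e]: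
    all but the last avoid [x], and the last one avoids [next c x] since the cycle has length over
    2. *)
Lemma connect_cycle_edge T (c : seq V) x e :
  ucycle (sub_adj T) c -> 2 < size c -> x \in c -> val e = [set x; next c x] ->
  connect (sub_adj (T :\ e)) x (next c x).
Proof.
move=> uc c2 /rot_to[i s rot_c]; have /andP[_ uniq_c] := uc.
rewrite -(next_rot i uniq_c) rot_c; move: uc c2.
rewrite -(rot_ucycle i) -(size_rot i) rot_c.
case: s rot_c => [|y [|z q]] _ // /andP[]; rewrite /= eqxx rcons_path.
move=> /andP[_ /andP[yz /andP[pq lastx]]] /and3P[xN yN uq] _ ve0.
have {ve0}ve : val e = [set x; y] := ve0.
rewrite (sym_connect_sym (sub_adj_sym _)); apply/connectP.
have xN' : all (predC1 x) [:: y, z & q].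
  by apply/allP => u uq'; rewrite inE; apply: contraNneq xN => <-.
exists (rcons (z :: q) x); last by rewrite last_rcons.
rewrite rcons_path; apply/andP; split.
  apply: (@sub_in_path _ (predC1 x) (sub_adj T)) xN' _ => [u v ux vx|]; last first.
    by rewrite /= yz.
  case/sub_adjP=> e' e'T ve'; apply/sub_adjP; exists e' => //.
  rewrite in_setD1 e'T andbT; apply: contraTneq isT => ee.
  by move: ve'; rewrite ee ve => /set2_eq[] [xu _]; rewrite !inE xu eqxx in ux vx.
have /sub_adjP[e' e'T ve'] := lastx.
apply/sub_adjP; exists e' => //; rewrite in_setD1 e'T andbT.
apply: contraNneq yN => ee; move: ve'; rewrite ee ve => /set2_eq[] [].
  move=> /= xl _; case/negP: xN.
  by have := mem_last z q; rewrite -xl => xq; rewrite in_cons xq orbT.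
by move=> _ ->; apply: mem_last.
Qed.

(* Every vertex that is not a root is charged to the first edge of a shortest
   path to its root. *)
Lemma card_leq_roots T : #|V| <= #|T| + #|roots (sub_adj T)|.
Proof.
set e := sub_adj T.
have csym : connect_sym e := sym_connect_sym (sub_adj_sym T).
have ex_path x : exists m,
    [exists p : m.-tuple V, path e x p && (last x p == fingraph.root e x)].
  have /connectP[p px lp] := connect_root e x; exists (size p).
  by apply/existsP; exists (in_tuple p); rewrite px -lp eqxx.
pose d x := ex_minn (ex_path x).
have step x : fingraph.root e x != x -> exists2 y, e x y & d y < d x.
  rewrite {2}/d; case: ex_minnP => m /existsP[[[|y p] /= /eqP <-]] /=.
    by rewrite eq_sym => ->.
  case/andP=> /andP[xy py] lp _ _; exists y => //.
  rewrite ltnS /d; case: ex_minnP => n _; apply.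
  apply/existsP; exists (in_tuple p); rewrite py (eqP lp) /=.
  by apply/eqP/(fingraph.rootP csym)/connect1.
pose P x (o : option (edge G)) := fingraph.root e x != x ->
  exists y, exists a, [/\ o = Some a, a \in T, val a = [set x; y] & d y < d x].
have /fin_all_exists[g gP] : forall x, exists o, P x o.
  move=> x; have [rx|rx] := eqVneq (fingraph.root e x) x.
    by exists None; rewrite /P rx eqxx.
  have [y /sub_adjP[a aT va] dyx] := step x rx.
  by exists (Some a) => _; exists y, a.
pose D := [set x | fingraph.root e x != x].
have -> : #|V| = #|D| + #|roots e|.
  rewrite -(cardsC D); congr (_ + _); apply: eq_card => x.
  by rewrite !inE negbK.
rewrite leq_add2r -(card_in_imset (f := g) (D := D)).
  rewrite -(card_imset T (@Some_inj _)); apply: subset_leq_card.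
  apply/subsetP => _ /imsetP[x + ->]; rewrite inE => /(gP x)[y [a [-> aT _ _]]].
  exact: imset_f.
(* Injectivity of the charging: if distinct [x] and [x'] were charged to the same edge, each would
   be the next vertex of the other, and [d] would decrease both ways. *)
move=> x x'; rewrite !inE => /(gP x)[y [a [-> _ va dy]]].
case/(gP x')=> y' [a' [-> _ va' dy']] [aa].
move: va'; rewrite -aa va => /set2_eq[] [xx yy] //.
by move: dy dy'; rewrite xx yy; clear; lia.
Qed.

(** Let [F] be a minimal subset of [E] with the same connectivity, and [T] a minimal connected edge
    set containing [F]. A cycle of [T] contradicts the minimality of [F] if it lies in [F], and that
    of [T] otherwise. *)
Lemma exists_spanning_tree E :
  (forall x y, connect (adj G) x y) ->
  exists2 T, spanning_tree T & #|V| <= #|T :&: E| + #|roots (sub_adj E)|.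
Proof.
move=> conn.
pose P F := [forall x, forall y, connect (sub_adj E) x y ==> connect (sub_adj F) x y].
have PE : P E by do 2!apply/forallP=> ?; apply/implyP.
have [F /minsetP[PF minF] FE] := minset_exists PE.
pose Q T := sub_connected T && (F \subset T).
have QT : Q setT.
  rewrite /Q subsetT andbT; do 2!apply/forallP=> ?.
  apply: connect_sub (conn _ _) => x y /adj_edge[e ve].
  by apply/connect1/sub_adjP; exists e.
have [T /minsetP[/andP[connT FT] minT] _] := minset_exists QT.
have connE_F x y : connect (sub_adj E) x y -> connect (sub_adj F) x y.
  by have /forallP/(_ x)/forallP/(_ y)/implyP := PF.
exists T; last first.
  have -> : #|roots (sub_adj E)| = #|roots (sub_adj F)|.
    apply: eq_card => x; rewrite !inE /fingraph.root.
    congr (odflt _ _ == _); apply: eq_pick => y; apply/idP/idP; first exact: connE_F.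
    apply: connect_sub => u v /sub_adjP[e eF ve].
    by apply/connect1/sub_adjP; exists e => //; apply: (subsetP FE).
  apply: leq_trans (card_leq_roots F) _; rewrite leq_add2r subset_leq_card //.
  by rewrite subsetI FT.
rewrite /spanning_tree connT; apply/forallP => k; apply/implyP => k2.
apply/forallP => c; apply/negP => uc.
have c2 : 2 < size c by rewrite size_tuple.
have /andP[cyc_c uniq_c] := uc.
have [/allP allF|/allPn[x xc xF]] :=
    boolP (all (fun x => sub_adj F x (next c x)) c).
  have [x xc] : exists x, x \in tval c.
    by case: (tval c) c2 => // x s _; exists x; rewrite mem_head.
  have /sub_adjP[e eF ve] := allF x xc.
  have ucF : ucycle (sub_adj F) c.
    by rewrite /ucycle uniq_c andbT; apply: cycle_from_next.
  have cF := connect_cycle_edge ucF c2 xc ve.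
  have PFe : P (F :\ e).
    apply/forallP=> u; apply/forallP=> v; apply/implyP=> /connE_F.
    exact: connect_setD1 ve cF u v.
  by have := eF; rewrite -(minF _ PFe (subsetDl _ _)) setD11.
have /sub_adjP[e eT ve] := next_cycle cyc_c xc.
have eF : e \notin F by apply: contra xF => eF; apply/sub_adjP; exists e.
have cT := connect_cycle_edge uc c2 xc ve.
have QTe : Q (T :\ e).
  rewrite /Q subsetD1 FT eF !andbT; apply/forallP=> u; apply/forallP=> v.
  by apply: (connect_setD1 ve cT); have /forallP/(_ u)/forallP := connT.
by have := eT; rewrite -(minT _ QTe (subsetDl _ _)) setD11.
Qed.

End SpanningTrees.

(** * Monochromatic components as blobs *)

Section ColourCover.
Variables (V : finType) (G : sgraph V) (r : nat) (f : {ffun edge G -> 'I_r}).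

Definition colour_class (i : 'I_r) : {set edge G} := [set e | f e == i].

Definition component (i : 'I_r) (x : V) : {set V} :=
  [set y | fingraph.root (sub_adj (colour_class i)) y == x].

(** Indexing by colour and canonical root lists each nontrivial component exactly once. *)
Definition blob_set : {set 'I_r * V} :=
  [set b | (b.2 \in roots (sub_adj (colour_class b.1)))
           && (1 < #|component b.1 b.2|)].

Definition blob : finType := {b : 'I_r * V | b \in blob_set}.

(** The components of one colour partition [V]; each contributes its size minus one, plus one for
    its root, and singletons add nothing to the first sum. *)
Lemma sum_component_roots i :
  \sum_(b : blob | (val b).1 == i) #|component (val b).1 (val b).2|.-1
    + #|roots (sub_adj (colour_class i))| <= #|V|.
Proof.
set R := roots _.
apply: (@leq_trans (\sum_(x in R) #|component i x|.-1 + #|R|)).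
  rewrite leq_add2r.
  rewrite -(big_sub_cond _ (fun b => b.1 == i) 
    (fun b => #|component b.1 b.2|.-1)).
  have -> : \sum_(b in blob_set | b.1 == i) #|component b.1 b.2|.-1 =
      \sum_(j < r) \sum_x
        if ((j, x) \in blob_set) && (j == i) then #|component j x|.-1 else 0.
    by rewrite pair_big big_mkcond; apply: eq_bigr => -[].
  rewrite (bigD1 i) //= [X in _ + X]big1 ?addn0 => [|j /negPf ji]; last first.
    by apply: big1 => x _; rewrite ji andbF.
  rewrite [leqRHS]big_mkcond; apply: leq_sum => x _; rewrite inE eqxx andbT.
  by case: ifP => // /andP[/= -> _].
rewrite -sum1_card -big_split /=.
have csym := sym_connect_sym (sub_adj_sym (colour_class i)).
rewrite -cardsT (card_fibers setT (fingraph.root (sub_adj (colour_class i)))).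
rewrite big_mkcond; apply: leq_sum => x _; case: ifP => // xR.
have -> : component i x =
    [set y in setT | fingraph.root (sub_adj (colour_class i)) y == x].
  by apply/setP => y; rewrite !inE.
rewrite addn1 prednK //; apply/card_gt0P; exists x.
by rewrite !inE.
Qed.

Lemma adj_blob x y : adj G x y -> exists b : blob,
  (x \in component (val b).1 (val b).2) && (y \in component (val b).1 (val b).2).
Proof.
move=> xy; have [e ve] := adj_edge xy; pose e0 := sub_adj (colour_class (f e)).
have csym : connect_sym e0 := sym_connect_sym (sub_adj_sym _).
have exy : e0 x y by apply/sub_adjP; exists e; rewrite ?inE.
have xK : x \in component (f e) (fingraph.root e0 x) by rewrite inE.
have yK : y \in component (f e) (fingraph.root e0 x).
  by rewrite inE; apply/eqP/esym/(fingraph.rootP csym)/connect1.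
have bP : (f e, fingraph.root e0 x) \in blob_set.
  rewrite inE; apply/andP; split; first exact: (roots_root csym).
  apply/card_gt1P; exists x, y; split=> //.
  by apply: contraTneq xy => ->; rewrite adj_irrefl.
by exists (exist (fun b => b \in blob_set) _ bP); rewrite /= xK yK.
Qed.

End ColourCover.

(** * From small discrepancy to a small separator *)

Local Open Scope ring_scope.

Lemma fin_max_ge (I : finType) (P : pred I) (F : I -> rat) (i : I) :
  P i -> F i <= fin_max P F.
Proof.
move=> Pi; rewrite /fin_max; case: pickP => [i0 Pi0|/(_ i)]; last by rewrite Pi.
by case: arg_maxP => // j _; apply.
Qed.

Lemma fin_min_attained (I : finType) (F : I -> rat) (i : I) :
  exists j, fin_min xpredT F = F j.
Proof.
rewrite /fin_min; case: pickP => [i0 _|/(_ i) //].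
by exists [arg min_(k < i0) F k]%O.
Qed.

(* The roots count the components, so [#|V| - #|roots _|] is the rank of a
   colour class. *)
Lemma discrepancy_lt_colouring (V : finType) (G : sgraph V) (r k : nat) :
  (1 < r)%N -> (forall x y, connect (adj G) x y) -> (0 < #|V|)%N ->
  spanning_tree_discrepancy G r < k%:R ->
  exists f : {ffun edge G -> 'I_r}, forall i,
    (r * #|V| + 2 <= #|V| + k + r * #|roots (sub_adj (colour_class f i))|)%N.
Proof.
move=> r1 conn V0; rewrite /spanning_tree_discrepancy.
(* The constant colouring shows that the minimum is over a nonempty range, so it is attained. *)
have [f ->] := fin_min_attained (fun f : {ffun edge G -> 'I_r} =>
  fin_max (spanning_tree (G := G)) (tree_disc f)) [ffun=> Ordinal (ltnW r1)].
move=> disc_k; exists f => i.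
have [T treeT cardT] := exists_spanning_tree (colour_class f i) conn.
have := le_lt_trans (fin_max_ge (tree_disc f) treeT) disc_k.
rewrite /tree_disc; set m := (\max_(j < r) _)%N.
have r0 : (r%:R : rat) != 0 by rewrite pnatr_eq0 -lt0n ltnW.
rewrite mulrBr mulrCA divff // mulr1.
move=> disc_lt.
(* This is [r * m - (#|V| - 1) < k] over the integers; its strictness gives the [+ 2] of the
   conclusion. *)
have lt_k : (r * m + 1 < #|V| + k)%N.
  by rewrite -(ltr_nat rat) !natrD natrM; move: disc_lt; lra.
have le_m : (#|T :&: colour_class f i| <= m)%N.
  apply: leq_trans (leq_bigmax i); apply: subset_leq_card.
  by apply/subsetP => e; rewrite !inE.
have := leq_mul (leqnn r) (leq_trans cardT (leq_add le_m (leqnn _))).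
by move: lt_k; rewrite mulnDr; clear; lia.
Qed.

Lemma sep_number_discrepancy (V : finType) (G : sgraph V) (r k : nat) :
  (1 < r)%N -> spanning_tree_discrepancy G r < k%:R ->
  (k_connected G 3 -> (0 < k)%N /\ (sep_number G r <= r * (7 * k))%N) /\
  (forall M, k_connected G 2 -> (0 < M)%N -> (#|V| <= M * M)%N ->
     (0 < k)%N /\ (sep_number G r <= 20 * (r * r) * (k + M))%N).
Proof.
move=> r1 disc_k.
have cover : k_connected G 2 -> exists f : {ffun edge G -> 'I_r},
    forall i, (r * \sum_(b : blob f | (val b).1 == i)
      #|component f (val b).1 (val b).2|.-1 + 2 <= #|V| + k)%N.
  move=> conn2.
  have conn x y : connect (adj G) x y by apply: k_connected_connect conn2.
  have V0 : (0 < #|V|)%N by case: conn2 => V2 _; apply: ltn_trans V2.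
  have [f hf] := discrepancy_lt_colouring r1 conn V0 disc_k.
  exists f => i; have := leq_mul (leqnn r) (sum_component_roots f i).
  by move: (hf i); rewrite mulnDr; clear; lia.
have blob_gt1 (f : {ffun edge G -> 'I_r}) (b : blob f) :
    (1 < #|component f (val b).1 (val b).2|)%N.
  by have := valP b; rewrite inE => /andP[].
split=> [conn3|M conn2 M0 VM].
  have [f hf] := cover (k_connectedW (isT : (2 <= 3)%N) conn3).
  exact: sep_number_3connected r1 (@adj_blob _ _ _ f) (@blob_gt1 f) hf conn3.
have [f hf] := cover conn2.
exact (sep_number_2connected r1 (@adj_blob _ _ _ f) (@blob_gt1 f) hf conn2 M0 VM).
Qed.

(** [M] is the square root of [n] rounded up. *)
Lemma exists_tight_square (n : nat) :
  (0 < n)%N -> exists2 M, (0 < M)%N & (n <= M * M <= 4 * n)%N.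
Proof.
move=> n0; have ex : exists M, (n <= M * M)%N by exists n; rewrite leq_pmulr.
case: (ex_minnP ex) => [[|M]] nM minM; first by move: n0 nM; clear; lia.
exists M.+1; rewrite // nM /=.
have := contra (minM M); rewrite -!ltnNge => /(_ (ltnSn M)).
by move: n0; clear; nia.
Qed.

Theorem theorem1p1 (R : realType) (r : nat) (hr : (2 <= r)%N) :
  exists2 C : R, 0 < C &
    forall (V : finType) (G : sgraph V),
      k_connected G 3 \/
      (k_connected G 2 /\ C * Num.sqrt #|V|%:R <= (sep_number G r)%:R) ->
      (Num.floor ((sep_number G r)%:R / C))%:~R
        <= spanning_tree_discrepancy G r.
Proof.
(* The binding case is the second: [s <= 20 * r^2 * (k + M)], [c * k <= s] and [c * M <= 2 * s] give
   [c * s <= 60 * r^2 * s], impossible for [c = 100 * r^2] and [s > 0]. *)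
have [c c_def] : exists c, c = (100 * (r * r))%N by exists (100 * (r * r))%N.
have c0 : (0 < c)%N by rewrite c_def !muln_gt0 !(ltnW hr).
have C0 : 0 < c%:R :> R by rewrite ltr0n.
exists c%:R => // V G hG; set s := sep_number G r in hG *.
have fl0 : 0 <= Num.floor (s%:R / c%:R : R) by rewrite floor_ge0 divr_ge0 ?ler0n.
have [k flk] : exists k : nat, Num.floor (s%:R / c%:R : R) = k%:Z.
  by exists `|Num.floor (s%:R / c%:R : R)|%N; rewrite gez0_abs.
rewrite leNgt; apply/negP; rewrite flk -pmulrn => disc_k.
have cks : (k * c <= s)%N.
  have := floor_le (s%:R / c%:R : R); rewrite flk -pmulrn.
  by rewrite ler_pdivlMr // -natrM ler_nat.
(* Both cases also yield [0 < k], which excludes a zero floor and makes [s] positive. *)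
have [case3 case2] := sep_number_discrepancy hr disc_k.
case: hG => [/case3[k0]|[conn2]].
  by rewrite -/s; move: cks; rewrite c_def; clear -hr k0; nia.
have V0 : (0 < #|V|)%N by case: conn2 => V2 _; apply: ltn_trans V2.
rewrite -ler_pdivlMl // => sqrt_le.
have [M M0 /andP[VM MV]] := exists_tight_square V0.
have [k0] := case2 M conn2 M0 VM; rewrite -/s.
have csV : (c * c * #|V| <= s * s)%N.
  rewrite -(ler_nat R) !natrM.
  have := ler_pM (sqrtr_ge0 _) (sqrtr_ge0 _) sqrt_le sqrt_le.
  rewrite -expr2 sqr_sqrtr ?ler0n // => le_n.
  have cn0 : (c%:R : R) != 0 by rewrite lt0r_neq0.
  have -> : s%:R * s%:R = c%:R * c%:R * (c%:R^-1 * s%:R * (c%:R^-1 * s%:R)) :> R.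
    by field.
  by rewrite ler_pM2l ?mulr_gt0.
(* Squared, this is [c^2 * M^2 <= 4 * c^2 * #|V| <= 4 * s^2]. *)
have cM : (c * M <= 2 * s)%N.
  rewrite -leq_sqr !expnMn.
  have := leq_mul (leqnn (c * c)) MV; move: csV; clear; nia.
move: cks cM; rewrite c_def; clear -hr k0; nia.
Qed.
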